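(* The coefficients $\alpha_k$ of the asymptotic expansion $\pi G_n\sim \ln(16N)+\gamma+\sum_{k=1}^\infty \frac{\alpha_k}{N^k}$ ($n\to\infty$, $N=n+1$) of the Landau constants $G_n$ satisfy $$(-1)^{\frac{l(l+1)}{2}}\,\alpha_{l+1}<0,\qquad l=0,1,2,\dots.$$
   Context: The Landau constants are $G_0=1$ and $G_n=1+\left(\frac12\right)^2+\left(\frac{1\cdot 3}{2\cdot 4}\right)^2+\cdots+\left(\frac{1\cdot3\cdots(2n-1)}{2\cdot4\cdots(2n)}\right)^2$ for $n=1,2,\dots$. Write $N=n+1$, and let $\gamma=0.577215\ldots$ be Euler's constant. It is known that there are (unique) real constants $\alpha_1,\alpha_2,\dots$ such that, as $n\to\infty$, $\pi G_n\sim \ln(16N)+\gamma+\sum_{k=1}^\infty\frac{\alpha_k}{N^k}$; that is, for every integer $m\ge 0$, $\pi G_n=\ln(16N)+\gamma+\sum_{k=1}^m\frac{\alpha_k}{N^k}+O(N^{-m-1})$ as $n\to\infty$. *)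

(* Defs.v *)
From Stdlib Require Import Reals.
From Coquelicot Require Import Coquelicot.

Open Scope R_scope.

(** [dfact_ratio k] is (1·3···(2k-1)) / (2·4···(2k)), the empty products being 1. *)
Fixpoint dfact_ratio (k : nat) : R :=
  match k with
  | O => 1
  | S j => dfact_ratio j * ((2 * INR j + 1) / (2 * INR j + 2))
  end.

Definition landau (n : nat) : R := sum_n (fun k => dfact_ratio k ^ 2) n.

Definition euler_gamma : R :=
  real (Lim_seq (fun n => sum_n_m (fun k => / INR k) 1 n - ln (INR n))).

(** [alpha k] is the coefficient of [N^-k], where [N = n + 1]; only the values
    at [k >= 1] matter, and [sum_n_m _ 1 0] is the empty sum. *)
Definition landau_expansion (alpha : nat -> R) : Prop :=
  forall m : nat, exists C : R,
    eventually (fun n : nat =>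
      Rabs (PI * landau n
            - (ln (16 * INR (n + 1)) + euler_gamma
               + sum_n_m (fun k => alpha k / INR (n + 1) ^ k) 1 m))
      <= C / INR (n + 1) ^ (m + 1)).

(* Main.v *)
(* Replace [N^(-k-1)] by [t^k / k!] (Borel transform): multiplication by [N] becomes
   [d/dt] and [N -> N + 1] becomes multiplication by [e = exp (- t)]. The recurrence of
   [PI (G_n - G_(n-1)) = PI dfact_ratio n ^ 2] becomes the differential equation
   [4 (e - 1) g'' = 4 g' + g] with [t g = (1 - t a) (1 - e)], [a_k = alpha_(k+1) / k!].
   Its solution is [g = exp (- t/4) y], [y = P_{-1/2} (cosh (t/2))] even. With [x = t/4],
     [1 - t a = y (x / sinh x) + x (y / cosh x)],
   and, as series in [z = - x^2], the functions [x / sinh x], [1 / cosh x] and [y] have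
   nonnegative coefficients, because Riccati-type equations give each coefficient as
   a nonnegative combination of the preceding ones. *)
Require Import Defs.
From Stdlib Require Import Reals Arith Lra Lia FunctionalExtensionality.
From Coquelicot Require Import Coquelicot.

Open Scope R_scope.

(** * The differential ring of formal power series *)

Definition fps := nat -> R.

Declare Scope fps_scope.
Delimit Scope fps_scope with fps.
Bind Scope fps_scope with fps.

Definition fps_add (a b : fps) : fps := fun n => a n + b n.
Definition fps_opp (a : fps) : fps := fun n => - a n.
Definition fps_sub (a b : fps) : fps := fun n => a n - b n.
Definition fps_scal (r : R) (a : fps) : fps := fun n => r * a n.
Definition fps_zero : fps := fun _ => 0.
Definition fps_one : fps := fun n => match n with O => 1 | _ => 0 end.
Definition fps_tl (a : fps) : fps := fun n => a (S n).
Definition fps_X : fps := fun n => match n with 1%nat => 1 | _ => 0 end.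
Definition fps_deriv (a : fps) : fps := fun n => INR (S n) * a (S n).

(* Cauchy product, by recursion on [(a_0 + X a') b = a_0 b + X (a' b)]. *)
Definition fps_mul : fps -> fps -> fps :=
  fix mul (a b : fps) (n : nat) : R :=
    match n with
    | O => a O * b O
    | S m => mul (fps_tl a) b m + a O * b n
    end.

Infix "+" := fps_add : fps_scope.
Infix "-" := fps_sub : fps_scope.
Infix "*" := fps_mul : fps_scope.
Notation "- a" := (fps_opp a) : fps_scope.
Notation "0" := fps_zero : fps_scope.
Notation "1" := fps_one : fps_scope.
Notation "2" := (fps_add fps_one fps_one) : fps_scope.
Notation "4" := (fps_add (fps_add fps_one fps_one) (fps_add fps_one fps_one)) : fps_scope.
Notation "a ^`" := (fps_deriv a) (at level 8, format "a ^`") : fps_scope.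

(** The mirror image of the defining recursion; comparing the two gives commutativity. *)
Lemma fps_mul_Sr (n : nat) : forall a b : fps,
  fps_mul a b (S n) = fps_mul a (fps_tl b) n + a (S n) * b O.
Proof.
  induction n as [|n IH]; intros a b.
  - simpl; unfold fps_tl; ring.
  - change (fps_mul a b (S (S n)))
      with (fps_mul (fps_tl a) b (S n) + a O * b (S (S n))).
    rewrite IH; simpl; unfold fps_tl; ring.
Qed.

Lemma fps_mulC (a b : fps) : fps_mul a b = fps_mul b a.
Proof.
  apply functional_extensionality; intro n; revert a b.
  induction n as [|n IH]; intros a b.
  - simpl; ring.
  - rewrite (fps_mul_Sr n b a); simpl; rewrite IH; ring.
Qed.

Lemma fps_mulDl (a b c : fps) : ((a + b) * c = a * c + b * c)%fps.
Proof.
  apply functional_extensionality; intro n; revert a b.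
  induction n as [|n IH]; intros a b; unfold fps_add at 2; simpl.
  - unfold fps_add; ring.
  - change (fps_tl (a + b)%fps) with (fps_tl a + fps_tl b)%fps.
    rewrite IH; unfold fps_add; ring.
Qed.

Lemma fps_mulZl (r : R) (a b : fps) :
  fps_mul (fps_scal r a) b = fps_scal r (fps_mul a b).
Proof.
  apply functional_extensionality; intro n; revert a.
  induction n as [|n IH]; intros a; unfold fps_scal at 2; simpl.
  - unfold fps_scal; ring.
  - change (fps_tl (fps_scal r a)) with (fps_scal r (fps_tl a)).
    rewrite IH; unfold fps_scal; ring.
Qed.

Lemma fps_tl_mul (a b : fps) :
  fps_tl (fps_mul a b) = (fps_tl a * b + fps_scal (a O) (fps_tl b))%fps.
Proof. reflexivity. Qed.

Lemma fps_mulA (a b c : fps) : (a * (b * c) = a * b * c)%fps.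
Proof.
  apply functional_extensionality; intro n; revert a.
  induction n as [|n IH]; intros a.
  - simpl; ring.
  - change ((fps_tl a * (b * c))%fps n + a O * (b * c)%fps (S n)
      = (fps_tl (a * b) * c)%fps n + a O * b O * c (S n)).
    rewrite fps_tl_mul, fps_mulDl, fps_mulZl, IH.
    unfold fps_add, fps_scal; simpl; ring.
Qed.

Lemma fps_mul0l (a : fps) : (0 * a = 0)%fps.
Proof.
  apply functional_extensionality; intro n.
  induction n as [|n IH]; [simpl; unfold fps_zero; ring|].
  change ((0 * a)%fps (S n)) with ((0 * a)%fps n + 0 * a (S n)).
  rewrite IH; unfold fps_zero; ring.
Qed.

Lemma fps_mul1l (a : fps) : (1 * a = a)%fps.
Proof.
  apply functional_extensionality; intros [|n]; [simpl; ring|].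
  change ((1 * a)%fps (S n)) with ((0 * a)%fps n + 1 * a (S n)).
  rewrite fps_mul0l; unfold fps_zero; ring.
Qed.

Lemma fps_ring_theory :
  ring_theory fps_zero fps_one fps_add fps_mul fps_sub fps_opp eq.
Proof.
  split; intros; try (apply functional_extensionality; intro;
    unfold fps_add, fps_sub, fps_opp, fps_zero; ring).
  - apply fps_mul1l.
  - apply fps_mulC.
  - apply fps_mulA.
  - apply fps_mulDl.
Qed.

Add Ring fps_ring : fps_ring_theory.

Lemma fps_mulX0 (a : fps) : (fps_X * a)%fps O = 0.
Proof. simpl; unfold fps_X; ring. Qed.

Lemma fps_mulXS (a : fps) (n : nat) : (fps_X * a)%fps (S n) = a n.
Proof.
  change ((fps_X * a)%fps (S n)) with ((1 * a)%fps n + 0 * a (S n)).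
  rewrite fps_mul1l; ring.
Qed.

Lemma fps_scalE (r : R) (a : fps) : fps_scal r a = fps_mul (fps_scal r 1%fps) a.
Proof. now rewrite fps_mulZl, fps_mul1l. Qed.

Lemma fps_decomp (a : fps) : a = (fps_scal (a O) 1 + fps_X * fps_tl a)%fps.
Proof.
  apply functional_extensionality; intros [|n]; unfold fps_add, fps_scal.
  - rewrite fps_mulX0; simpl; ring.
  - rewrite fps_mulXS; unfold fps_tl; simpl; ring.
Qed.

Lemma fps_derivD (a b : fps) : ((a + b)^` = a^` + b^`)%fps.
Proof.
  apply functional_extensionality; intro n; unfold fps_deriv, fps_add; ring.
Qed.

Lemma fps_derivB (a b : fps) : ((a - b)^` = a^` - b^`)%fps.
Proof.
  apply functional_extensionality; intro n; unfold fps_deriv, fps_sub; ring.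
Qed.

Lemma fps_derivZ (r : R) (a : fps) : fps_deriv (fps_scal r a) = fps_scal r (fps_deriv a).
Proof.
  apply functional_extensionality; intro n; unfold fps_deriv, fps_scal; ring.
Qed.

Lemma fps_deriv1 : (1^` = 0)%fps.
Proof.
  apply functional_extensionality; intro n; unfold fps_deriv, fps_zero; simpl; ring.
Qed.

Lemma fps_derivX : (fps_X^` = 1)%fps.
Proof.
  apply functional_extensionality; intros [|n]; unfold fps_deriv, fps_X; simpl; ring.
Qed.

Lemma fps_tl_deriv (a : fps) :
  fps_tl (fps_deriv a) = (fps_deriv (fps_tl a) + fps_tl (fps_tl a))%fps.
Proof.
  apply functional_extensionality; intro n.
  unfold fps_tl, fps_deriv, fps_add; rewrite (S_INR (S n)); ring.
Qed.

Lemma fps_derivM (a b : fps) : ((a * b)^` = a^` * b + a * b^`)%fps.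
Proof.
  apply functional_extensionality; intro n; revert a b.
  induction n as [|n IH]; intros a b.
  - unfold fps_deriv, fps_add; simpl; unfold fps_tl; ring.
  - specialize (IH (fps_tl a) b).
    unfold fps_deriv at 1; unfold fps_deriv at 1 in IH.
    change ((a * b)%fps (S (S n)))
      with ((fps_tl a * b)%fps (S n) + a O * b (S (S n))).
    rewrite Rmult_plus_distr_l, (S_INR (S n)), Rmult_plus_distr_r, IH.
    unfold fps_add at 2.
    change ((a^` * b)%fps (S n))
      with ((fps_tl a^` * b)%fps n + a^`%fps O * b (S n)).
    change ((a * b^`)%fps (S n))
      with ((fps_tl a * b^`)%fps n + a O * b^`%fps (S n)).
    change ((fps_tl a * b)%fps (S n))
      with ((fps_tl (fps_tl a) * b)%fps n + a 1%nat * b (S n)).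
    rewrite fps_tl_deriv, fps_mulDl; unfold fps_add, fps_deriv.
    rewrite !(S_INR (S n)); simpl (INR 1); ring.
Qed.

Lemma fps_tlD (a b : fps) : fps_tl (a + b)%fps = (fps_tl a + fps_tl b)%fps.
Proof. reflexivity. Qed.

Lemma fps_tlB (a b : fps) : fps_tl (a - b)%fps = (fps_tl a - fps_tl b)%fps.
Proof. reflexivity. Qed.

Lemma fps_tl_mulX (a : fps) : fps_tl (fps_X * a)%fps = a.
Proof. apply functional_extensionality; intro n; apply fps_mulXS. Qed.

(** * Locality and positivity of products; recursively defined series and inverses *)

Lemma fps_mul_ext (n : nat) : forall a a' b b' : fps,
  (forall k, (k <= n)%nat -> a k = a' k) -> (forall k, (k <= n)%nat -> b k = b' k) ->
  fps_mul a b n = fps_mul a' b' n.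
Proof.
  induction n as [|n IH]; intros a a' b b' Ha Hb; simpl.
  - rewrite Ha, Hb by lia; ring.
  - rewrite (IH (fps_tl a) (fps_tl a') b b'), Ha, Hb by (intros; try apply Ha; try apply Hb; lia).
    reflexivity.
Qed.

Lemma fps_mul_nonneg (n : nat) : forall a b : fps,
  (forall k, (k <= n)%nat -> 0 <= a k) -> (forall k, (k <= n)%nat -> 0 <= b k) ->
  0 <= fps_mul a b n.
Proof.
  induction n as [|n IH]; intros a b Ha Hb; simpl.
  - apply Rmult_le_pos; auto.
  - apply Rplus_le_le_0_compat.
    + apply IH; intros; try apply Ha; try apply Hb; lia.
    + apply Rmult_le_pos; [apply Ha | apply Hb]; lia.
Qed.

(** The term [a n * b O] is already positive, and the others are nonnegative. *)
Lemma fps_mul_pos (a b : fps) (n : nat) :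
  (forall k, 0 < a k) -> (forall k, 0 <= b k) -> 0 < b O -> 0 < fps_mul a b n.
Proof.
  intros Ha Hb Hb0; destruct n as [|n].
  - simpl; apply Rmult_lt_0_compat; auto.
  - rewrite fps_mul_Sr.
    apply Rplus_le_lt_0_compat; [|now apply Rmult_lt_0_compat].
    apply fps_mul_nonneg; intros; [apply Rlt_le, Ha | apply Hb].
Qed.

(** Iterating [F] from any start freezes coefficient [n] after [n + 1] rounds. This turns a
    recurrence over all earlier coefficients into a series. *)
Lemma causal_fixpoint (F : fps -> fps) :
  (forall n a b, (forall k, (k < n)%nat -> a k = b k) -> F a n = F b n) ->
  exists a, F a = a.
Proof.
  intro HF.
  set (it m := Nat.iter m F 0%fps).
  assert (stable : forall n m m', (n < m)%nat -> (n < m')%nat -> it m n = it m' n).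
  { induction n as [n IH] using lt_wf_ind; intros m m' Hm Hm'.
    destruct m as [|m]; [lia|]; destruct m' as [|m']; [lia|].
    apply HF; intros k Hk; apply IH; lia. }
  (* The diagonal picks each coefficient at the first iterate where it is final. *)
  exists (fun n => it (S n) n).
  apply functional_extensionality; intro n.
  apply (HF n _ (it n)); intros k Hk; apply stable; lia.
Qed.

(** With [a = 1 + X a'], the inverse solves [b = 1 - X a' b], where the factor [X] makes the right
    side causal. *)
Lemma fps_inv_exists (a : fps) : a O = 1 -> exists b, (a * b = 1)%fps.
Proof.
  intro Ha.
  destruct (causal_fixpoint (fun b => (1 - fps_X * (fps_tl a * b))%fps)) as [b Hb].
  - intros [|n] b c Hbc; unfold fps_sub.
    + now rewrite !fps_mulX0.
    + rewrite !fps_mulXS; f_equal.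
      apply fps_mul_ext; [easy|]; intros; apply Hbc; lia.
  - exists b; cbv beta in Hb.
    replace a with (1 + fps_X * fps_tl a)%fps.
    + transitivity (b + fps_X * (fps_tl a * b))%fps; [ring|].
      transitivity ((1 - fps_X * (fps_tl a * b)) + fps_X * (fps_tl a * b))%fps;
        [now rewrite Hb | ring].
    + rewrite (fps_decomp a) at 2; rewrite Ha; f_equal.
      apply functional_extensionality; intro; unfold fps_scal; ring.
Qed.

Lemma fps_mul_cancel (a b c : fps) : c O = 1 -> (a * c = b * c)%fps -> a = b.
Proof.
  intros Hc H; destruct (fps_inv_exists c Hc) as [d Hd].
  transitivity (a * c * d)%fps.
  - rewrite <- fps_mulA, Hd; ring.
  - rewrite H, <- fps_mulA, Hd; ring.
Qed.

Lemma fps_mulX_cancel (a b : fps) : (fps_X * a = fps_X * b)%fps -> a = b.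
Proof.
  intro H; apply functional_extensionality; intro n.
  now rewrite <- (fps_mulXS a), H, fps_mulXS.
Qed.

Lemma fps_deriv_inj (a b : fps) : a^`%fps = b^`%fps -> a O = b O -> a = b.
Proof.
  intros H H0; apply functional_extensionality; intros [|n]; [easy|].
  assert (Hn := f_equal (fun f => f n) H); unfold fps_deriv in Hn; simpl in Hn.
  apply Rmult_eq_reg_l with (INR (S n)); [exact Hn|].
  apply not_0_INR; lia.
Qed.

(** * Series in [t] split into even and odd parts *)

(* [phi A B] is the series [A(z) + (t/4) B(z)] in [t], where [z = - (t/4)^2]:
   removing the constant term and dividing by [t] exchanges the two parts. *)
Definition phi : fps -> fps -> fps :=
  fix phi (A B : fps) (n : nat) : R :=
    match n with
    | O => A O
    | S m => phi B (- fps_tl A)%fps m / 4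
    end.

Lemma phiD (A B A' B' : fps) : phi (A + A')%fps (B + B')%fps = (phi A B + phi A' B')%fps.
Proof.
  apply functional_extensionality; intro n; revert A B A' B'.
  induction n as [|n IH]; intros A B A' B'; [easy|].
  unfold fps_add at 3; cbn [phi].
  replace (- fps_tl (A + A'))%fps with (- fps_tl A + - fps_tl A')%fps.
  - rewrite IH; unfold fps_add; field.
  - apply functional_extensionality; intro; unfold fps_add, fps_opp, fps_tl; ring.
Qed.

Lemma phiZ (r : R) (A B : fps) : phi (fps_scal r A) (fps_scal r B) = fps_scal r (phi A B).
Proof.
  apply functional_extensionality; intro n; revert A B.
  induction n as [|n IH]; intros A B; [easy|].
  unfold fps_scal at 3; cbn [phi].
  replace (- fps_tl (fps_scal r A))%fps with (fps_scal r (- fps_tl A)%fps).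
  - rewrite IH; unfold fps_scal; field.
  - apply functional_extensionality; intro; unfold fps_scal, fps_opp, fps_tl; ring.
Qed.

(** Expand [(A + x B) (A' + x B')] with [x = t/4] and [x^2 = - z]; here [fps_X] stands for [z]. *)
Lemma phiM (A B A' B' : fps) :
  (phi A B * phi A' B' = phi (A * A' - fps_X * (B * B')) (A * B' + B * A'))%fps.
Proof.
  apply functional_extensionality; intro n; revert A B A' B'.
  induction n as [|n IH]; intros A B A' B'.
  - unfold fps_sub; cbn -[fps_X]; unfold fps_X; ring.
  - change ((phi A B * phi A' B')%fps (S n))
      with (fps_mul (fun m => phi B (- fps_tl A)%fps m / 4) (phi A' B') n
            + A O * (phi B' (- fps_tl A')%fps n / 4)).
    replace (fun m => phi B (- fps_tl A)%fps m / 4)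
      with (fps_scal (/ 4) (phi B (- fps_tl A)%fps))
      by (apply functional_extensionality; intro; unfold fps_scal; field).
    rewrite fps_mulZl; unfold fps_scal; rewrite IH; cbn [phi].
    transitivity ((phi (B * A' - fps_X * (- fps_tl A * B'))
                      (B * B' + - fps_tl A * A')
                  + phi (fps_scal (A O) B') (fps_scal (A O) (- fps_tl A')))%fps n / 4).
    { rewrite phiZ; unfold fps_add, fps_scal; field. }
    rewrite <- phiD; f_equal; f_equal.
    + rewrite (fps_decomp A) at 3; rewrite (fps_scalE (A O) B'); ring.
    + rewrite fps_tlB, fps_tl_mul, fps_tl_mulX, (fps_scalE _ (fps_tl A')),
        (fps_scalE _ (- fps_tl A')%fps); ring.
Qed.

(** Chain rule: [d/dt] is a quarter of [d/dx], and [dz/dx = - 2 x], so [A] contributes [- 2 x A']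
    and [x B] contributes [B + 2 z B']. *)
Lemma phi_deriv (A B : fps) :
  fps_deriv (phi A B)
  = fps_scal (/ 4) (phi (B + 2 * fps_X * B^`) (- (2 * A^`)))%fps.
Proof.
  apply functional_extensionality; intro n; revert A B.
  induction n as [|n IH]; intros A B.
  - unfold fps_deriv, fps_scal, fps_add; cbn; unfold fps_X, fps_tl; cbn; field.
  - unfold fps_scal; cbn [phi].
    (* Write [phi A B] as a constant plus [t f], with [4 f = phi B (- fps_tl A)]; the two terms come
       from [(t f)' = t f' + f]. *)
    replace (fps_deriv (phi A B) (S n))
      with ((fps_deriv (phi B (- fps_tl A)) n
             + phi (- fps_tl A) (- fps_tl B) n / 4) / 4).
    2:{ unfold fps_deriv; cbn [phi]; rewrite (S_INR (S n)); field. }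
    rewrite IH; unfold fps_scal.
    set (F := phi (- fps_tl A + 2 * fps_X * (- fps_tl A)^`) (- (2 * B^`))).
    transitivity ((F + phi (- fps_tl A) (- fps_tl B))%fps n / 16);
      [unfold fps_add; field | unfold F].
    rewrite <- phiD.
    replace (- fps_tl A + 2 * fps_X * (- fps_tl A)^` + - fps_tl A)%fps with (- (2 * A^`))%fps.
    replace (- (2 * B^`) + - fps_tl B)%fps with (- fps_tl (B + 2 * fps_X * B^`))%fps.
    + field.
    + replace (2 * fps_X * B^`)%fps with (fps_X * (2 * B^`))%fps by ring.
      rewrite fps_tlD, fps_tl_mulX; ring.
    + rewrite (fps_decomp A) at 1.
      rewrite fps_derivD, fps_derivZ, fps_deriv1, fps_derivM, fps_derivX.
      replace (fps_scal (A O) 0%fps) with 0%fps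
        by (apply functional_extensionality; intro; unfold fps_scal, fps_zero; ring).
      replace ((- fps_tl A)^`)%fps with (- (fps_tl A)^`)%fps
        by (apply functional_extensionality; intro; unfold fps_opp, fps_deriv; ring).
      ring.
Qed.

(** * Hyperbolic functions as series in [z] *)

(* With [z = - x^2], these are [cosh x] and [sinh x / x] as series in [z]. *)
Definition cosz : fps := fun k => (-1) ^ k / INR (fact (2 * k)).
Definition sinz : fps := fun k => (-1) ^ k / INR (fact (2 * k + 1)).

(** This is [(cosh x)' = sinh x], divided by [x]. *)
Lemma cosz_deriv : (cosz^` + cosz^` = - sinz)%fps.
Proof.
  apply functional_extensionality; intro n.
  unfold fps_add, fps_deriv, fps_opp, cosz, sinz.
  replace (2 * S n)%nat with (S (2 * n + 1)) by lia.
  rewrite (fact_simpl (2 * n + 1)), mult_INR.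
  replace (INR (S (2 * n + 1))) with (2 * INR (S n))
    by (rewrite !S_INR, plus_INR, mult_INR; simpl; ring).
  assert (Hf := INR_fact_neq_0 (2 * n + 1)).
  assert (Hn := not_0_INR (S n) ltac:(lia)).
  rewrite <- tech_pow_Rmult; field; auto.
Qed.

Lemma fps_X_derivE (a : fps) (n : nat) : (fps_X * a^`)%fps n = INR n * a n.
Proof.
  destruct n as [|n]; [rewrite fps_mulX0; simpl; ring|].
  now rewrite fps_mulXS.
Qed.

(** This is [(sinh x)' = cosh x], with [sinh x = x sinz]. *)
Lemma sinz_deriv : (sinz + (fps_X * sinz^` + fps_X * sinz^`) = cosz)%fps.
Proof.
  apply functional_extensionality; intro n.
  unfold fps_add; rewrite fps_X_derivE; unfold sinz, cosz.
  replace (2 * n + 1)%nat with (S (2 * n)) by lia.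
  rewrite fact_simpl, mult_INR, S_INR, (mult_INR 2 n).
  assert (Hf := INR_fact_neq_0 (2 * n)).
  assert (Hn := pos_INR n); simpl (INR 2); field; split; [exact Hf | lra].
Qed.

Lemma cosz0 : cosz O = 1.
Proof. unfold cosz; simpl; field. Qed.

Lemma sinz0 : sinz O = 1.
Proof. unfold sinz; simpl; field. Qed.

(** This is [cosh^2 x - sinh^2 x = 1]; the derivative of the left side vanishes. *)
Lemma cosz_sinz_sqr : (cosz * cosz + fps_X * (sinz * sinz) = 1)%fps.
Proof.
  apply fps_deriv_inj.
  - rewrite fps_deriv1, fps_derivD, !fps_derivM, fps_derivX.
    transitivity (cosz * (cosz^` + cosz^`)
      + sinz * (sinz + (fps_X * sinz^` + fps_X * sinz^`)))%fps; [ring|].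
    rewrite cosz_deriv, sinz_deriv; ring.
  - unfold fps_add; rewrite fps_mulX0; simpl; rewrite cosz0; ring.
Qed.

(** * Riccati equations and nonnegativity of the reciprocals *)

Lemma fps_inv_deriv (a b : fps) : (a * b = 1)%fps -> (b^` = - (a^` * b * b))%fps.
Proof.
  intro H; assert (Hd := f_equal fps_deriv H).
  rewrite fps_derivM, fps_deriv1 in Hd.
  transitivity (b^` * (a * b))%fps; [rewrite H; ring|].
  transitivity (b * (a^` * b + a * b^`) - a^` * b * b)%fps; [ring|].
  rewrite Hd; ring.
Qed.

Lemma fps_coef_eq (a b : fps) (n : nat) : a = b -> a n = b n.
Proof. now intros ->. Qed.

Lemma fps_X_mul_nonneg (a b : fps) (n : nat) :
  (forall k, (k < n)%nat -> 0 <= a k) -> (forall k, (k < n)%nat -> 0 <= b k) ->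
  0 <= (fps_X * (a * b))%fps n.
Proof.
  destruct n as [|n]; intros Ha Hb; [rewrite fps_mulX0; lra|].
  rewrite fps_mulXS; apply fps_mul_nonneg; intros; [apply Ha | apply Hb]; lia.
Qed.

Lemma fps_one_nonneg (n : nat) : 0 <= fps_one n.
Proof. destruct n; simpl; lra. Qed.

(* [sinz * u] is [tanh x / x]. *)
Lemma tanh_riccati (u : fps) (Hu : (cosz * u = 1)%fps) :
  let T := (sinz * u)%fps in (T + (fps_X * T^` + fps_X * T^`) = 1 + fps_X * (T * T))%fps.
Proof.
  intro T; unfold T; rewrite fps_derivM, (fps_inv_deriv _ _ Hu).
  transitivity ((sinz + (fps_X * sinz^` + fps_X * sinz^`)) * u
    - fps_X * sinz * (cosz^` + cosz^`) * u * u)%fps; [ring|].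
  rewrite cosz_deriv, sinz_deriv, Hu; ring.
Qed.

(* [2 z R] is [1 - x coth x]. *)
Lemma coth_riccati (v : fps) (Hv : (sinz * v = 1)%fps) :
  let R := (- (sinz^` * v))%fps in
  (4 * R + 2 * R + 4 * (fps_X * R^`) = 1 + 4 * (fps_X * (R * R)))%fps.
Proof.
  (* Differentiating and eliminating [cosz] gives a linear second-order equation for [sinz]; its
     negated logarithmic derivative [R] then satisfies a Riccati equation. *)
  intro R; assert (H := f_equal fps_deriv sinz_deriv).
  rewrite !fps_derivD, !fps_derivM, fps_derivX in H.
  unfold R.
  replace ((- (sinz^` * v))^`)%fps with (- (sinz^` * v)^`)%fps
    by (apply functional_extensionality; intro; unfold fps_opp, fps_deriv; ring).
  rewrite fps_derivM, (fps_inv_deriv _ _ Hv).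
  transitivity (4 * (fps_X * (sinz^` * v * (sinz^` * v)))
    - 2 * v * (sinz^` + ((1 * sinz^` + fps_X * sinz^`^`)
                       + (1 * sinz^` + fps_X * sinz^`^`))))%fps; [ring|].
  rewrite H.
  transitivity (4 * (fps_X * (sinz^` * v * (sinz^` * v)))
    - v * (cosz^` + cosz^`))%fps; [ring|].
  rewrite cosz_deriv, <- Hv; ring.
Qed.

(** Coefficient [n] of the Riccati equation equates [(2 n + 1) T_n] with a nonnegative expression in
    the earlier coefficients, since [fps_X] shifts the square. *)
Lemma tanh_nonneg (u : fps) (Hu : (cosz * u = 1)%fps) (n : nat) : 0 <= (sinz * u)%fps n.
Proof.
  set (T := (sinz * u)%fps).
  induction n as [n IH] using lt_wf_ind.
  assert (H := tanh_riccati u Hu); cbv zeta in H; fold T in H; apply (fps_coef_eq _ _ n) in H.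
  unfold fps_add in H; rewrite fps_X_derivE in H.
  assert (H1 := fps_one_nonneg n).
  assert (H2 := fps_X_mul_nonneg T T n IH IH).
  assert (Hn := pos_INR n); nra.
Qed.

(** As for [tanh], with the factor [4 n + 6] in front of [R_n]. *)
Lemma coth_nonneg (v : fps) (Hv : (sinz * v = 1)%fps) (n : nat) :
  0 <= (- (sinz^` * v))%fps n.
Proof.
  set (R := (- (sinz^` * v))%fps).
  induction n as [n IH] using lt_wf_ind.
  assert (H := coth_riccati v Hv); cbv zeta in H; fold R in H; apply (fps_coef_eq _ _ n) in H.
  rewrite !fps_mulDl, !fps_mul1l in H.
  unfold fps_add in H; rewrite fps_X_derivE in H.
  assert (H1 := fps_one_nonneg n).
  assert (H2 := fps_X_mul_nonneg R R n IH IH).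
  assert (Hn := pos_INR n); nra.
Qed.

(** The equation [2 u' = u T] gives each coefficient of [u] from earlier ones and those of [T], all
    nonnegative. *)
Lemma cosz_inv_nonneg (u : fps) (Hu : (cosz * u = 1)%fps) (n : nat) : 0 <= u n.
Proof.
  induction n as [n IH] using lt_wf_ind.
  destruct n as [|n].
  - assert (H := fps_coef_eq _ _ O Hu); simpl in H; rewrite cosz0 in H; lra.
  - assert (E : (u^` + u^` = u * (sinz * u))%fps).
    { rewrite (fps_inv_deriv _ _ Hu).
      transitivity (- ((cosz^` + cosz^`) * u * u))%fps; [ring|].
      rewrite cosz_deriv; ring. }
    assert (H := fps_coef_eq _ _ n E); unfold fps_add, fps_deriv in H.
    assert (Hm : 0 <= (u * (sinz * u))%fps n)
      by (apply fps_mul_nonneg; intros; [apply IH; lia | now apply tanh_nonneg]).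
    assert (Hn := pos_INR n); rewrite S_INR in H; nra.
Qed.

(** Same argument with [v' = v R]. *)
Lemma sinz_inv_nonneg (v : fps) (Hv : (sinz * v = 1)%fps) (n : nat) : 0 <= v n.
Proof.
  induction n as [n IH] using lt_wf_ind.
  destruct n as [|n].
  - assert (H := fps_coef_eq _ _ O Hv); simpl in H; rewrite sinz0 in H; lra.
  - assert (E : (v^` = v * - (sinz^` * v))%fps)
      by (rewrite (fps_inv_deriv _ _ Hv); ring).
    assert (H := fps_coef_eq _ _ n E).
    change (INR (S n) * v (S n) = (v * - (sinz^` * v))%fps n) in H.
    assert (Hm : 0 <= (v * - (sinz^` * v))%fps n)
      by (apply fps_mul_nonneg; intros; [apply IH; lia | now apply coth_nonneg]).
    assert (Hn := pos_INR n); rewrite S_INR in H; nra.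
Qed.

(** * The Legendre function and its positive coefficients *)

(* [Y] is the Legendre function [P_{-1/2} (cosh (2 x))]. *)
Lemma legendre_exists (u v : fps) (Hu : (cosz * u = 1)%fps) (Hv : (sinz * v = 1)%fps) :
  let T := (sinz * u)%fps in let R := (- (sinz^` * v))%fps in exists Y : fps,
  Y O = 1 /\ (forall n, 0 < Y n) /\
  (4 * (Y^` + fps_X * Y^`^`) = Y + fps_X * ((4 * R + 2 * T) * Y^`))%fps.
Proof.
  (* In the variable [x] the Legendre equation is [y'' + 2 coth (2 x) y' + y = 0], and [2 x coth (2
     x) = x coth x + x tanh x = 1 - z K / 2]. *)
  intros T R; set (K := (4 * R + 2 * T)%fps).
  assert (K_nonneg : forall n, 0 <= K n).
  { intro n; unfold K; rewrite !fps_mulDl, !fps_mul1l; unfold fps_add.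
    assert (H1 := coth_nonneg v Hv n); assert (H2 := tanh_nonneg u Hu n).
    fold R in H1; fold T in H2; lra. }
  (* Coefficient [m] of [Y' + z Y''] is [(m + 1)^2 Y_(m+1)], so the equation is this recurrence,
     with nonnegative terms on the right. *)
  destruct (causal_fixpoint (fun Y n => match n with
    | O => 1
    | S m => (Y m + (fps_X * (K * Y^`))%fps m) / (4 * INR (S m) ^ 2)
    end)) as [Y HY].
  { intros [|n] a b H; [easy|]; rewrite (H n) by lia; do 2 f_equal.
    destruct n as [|n]; [now rewrite !fps_mulX0|]; rewrite !fps_mulXS.
    apply fps_mul_ext; [easy|]; intros; unfold fps_deriv; rewrite H by lia; easy. }
  assert (Y0 : Y O = 1) by (rewrite <- HY; easy).
  assert (YS : forall n, 4 * INR (S n) ^ 2 * Y (S n) = Y n + (fps_X * (K * Y^`))%fps n).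
  { intro n; assert (H := fps_coef_eq _ _ (S n) HY); cbv beta iota in H.
    rewrite <- H; field; apply not_0_INR; lia. }
  assert (Ypos : forall n, 0 < Y n).
  { induction n as [n IH] using lt_wf_ind; destruct n as [|n]; [lra|].
    assert (H := YS n); assert (H0 := IH n ltac:(lia)).
    assert (HX : 0 <= (fps_X * (K * Y^`))%fps n).
    { apply fps_X_mul_nonneg; intros; [apply K_nonneg|].
      unfold fps_deriv; apply Rmult_le_pos; [apply pos_INR|].
      apply Rlt_le, IH; lia. }
    assert (Hn : 0 < INR (S n)) by (apply lt_0_INR; lia).
    assert (Hn2 : 0 < INR (S n) ^ 2) by (apply pow_lt; easy); nra. }
  exists Y; split; [easy|]; split; [easy|].
  apply functional_extensionality; intro n.
  unfold fps_add at 5; rewrite <- YS, !fps_mulDl, !fps_mul1l.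
  unfold fps_add; rewrite fps_X_derivE; unfold fps_deriv; rewrite S_INR; ring.
Qed.

(** * The exponential series and the explicit solution *)

(** These are [exp (- t)] and [(1 - exp (- t)) / t]; the latter is also the Borel transform of
    [ln (1 + 1/N)]. *)
Definition expneg : fps := fun n => (-1) ^ n / INR (fact n).
Definition expneg_quot : fps := fun n => (-1) ^ n / INR (fact (S n)).

Lemma expneg_quotE : (fps_X * expneg_quot = 1 - expneg)%fps.
Proof.
  apply functional_extensionality; intros [|n]; unfold fps_sub.
  - rewrite fps_mulX0; unfold expneg; simpl; field.
  - rewrite fps_mulXS; unfold expneg, expneg_quot; rewrite <- tech_pow_Rmult.
    change (fps_one (S n)) with 0%R.
    assert (Hf := INR_fact_neq_0 (S n)); field; auto.
Qed.

Lemma expneg_unique (f : fps) : (f^` = - f)%fps -> f O = 1 -> f = expneg.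
Proof.
  intros Hf H0; apply functional_extensionality; intro n.
  induction n as [|n IH]; [unfold expneg; rewrite H0; simpl; field|].
  assert (H := fps_coef_eq _ _ n Hf); unfold fps_opp in H; rewrite IH in H.
  change (INR (S n) * f (S n) = - expneg n) in H.
  assert (Hn := not_0_INR (S n) ltac:(lia)).
  apply Rmult_eq_reg_l with (INR (S n)); [rewrite H|easy].
  assert (Hf' := INR_fact_neq_0 n).
  unfold expneg; rewrite fact_simpl, mult_INR, <- tech_pow_Rmult; field; auto.
Qed.

Lemma phi_deriv4 (A B : fps) :
  (4 * (phi A B)^` = phi (B + 2 * fps_X * B^`) (- (2 * A^`)))%fps.
Proof.
  rewrite phi_deriv; set (F := phi _ _).
  apply functional_extensionality; intro n.
  rewrite !fps_mulDl, !fps_mul1l; unfold fps_add, fps_scal; field.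
Qed.

Lemma fps_mul4_inj (a b : fps) : (4 * a = 4 * b)%fps -> a = b.
Proof.
  intro H; apply functional_extensionality; intro n.
  apply (fps_coef_eq _ _ n) in H.
  rewrite !fps_mulDl, !fps_mul1l in H; unfold fps_add in H; lra.
Qed.

Lemma phi0 : phi 0%fps 0%fps = 0%fps.
Proof.
  apply functional_extensionality; intro n.
  assert (H := fps_coef_eq _ _ n (phiZ 0 0%fps 0%fps)).
  replace (fps_scal 0 0%fps) with 0%fps in H
    by (apply functional_extensionality; intro; unfold fps_scal, fps_zero; ring).
  rewrite H; unfold fps_scal, fps_zero; ring.
Qed.

Lemma phi_tl (A B : fps) (n : nat) : phi A B (S n) = phi B (- fps_tl A)%fps n / 4.
Proof. reflexivity. Qed.

Lemma phi1 : phi 1%fps 0%fps = 1%fps.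
Proof.
  apply functional_extensionality; intros [|n]; [easy|].
  rewrite phi_tl; replace (- fps_tl 1)%fps with 0%fps.
  - rewrite phi0; unfold fps_zero; simpl; field.
  - apply functional_extensionality; intro; unfold fps_opp, fps_tl, fps_zero; simpl; ring.
Qed.

Lemma phiX : phi 0%fps 4%fps = fps_X.
Proof.
  apply functional_extensionality; intros [|n]; [easy|].
  rewrite phi_tl.
  replace 4%fps with (fps_scal 4 1%fps)
    by (apply functional_extensionality; intro; unfold fps_scal, fps_add; ring).
  replace (- fps_tl 0)%fps with (fps_scal 4 0%fps)
    by (apply functional_extensionality; intro;
        unfold fps_scal, fps_opp, fps_tl, fps_zero; ring).
  rewrite phiZ, phi1; unfold fps_scal; destruct n; unfold fps_X; simpl; field.
Qed.

Lemma formal_solution : exists A B g : fps,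
  (forall n, 0 < A n) /\ (forall n, 0 < B n) /\ g O = 1 /\
  (4 * ((expneg - 1) * g^`^`) = 4 * g^` + g)%fps /\
  (phi A B * (1 - expneg) = fps_X * g)%fps.
Proof.
  destruct (fps_inv_exists cosz cosz0) as [u Hu].
  destruct (fps_inv_exists sinz sinz0) as [v Hv].
  destruct (legendre_exists u v Hu Hv) as (Y & Y0 & Ypos & HY).
  (* [q = exp (- t/4)], [r = exp (t/4)] *)
  set (q := phi cosz (- sinz)); set (r := phi cosz sinz).
  (* [d = 2 sinh (t/2)] and [s = 2 cosh (t/2)]. *)
  set (d := phi 0 (4 * (cosz * sinz)));
  set (s := phi (2 * (cosz * cosz - fps_X * (sinz * sinz))) 0).
  set (y := phi Y 0).
  assert (q0 : q O = 1) by exact cosz0.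
  assert (Hqr : (q * r = 1)%fps).
  { unfold q, r; rewrite phiM, <- phi1, <- cosz_sinz_sqr; f_equal; ring. }
  assert (Hd : (d = r * r - q * q)%fps).
  { transitivity ((q * q + d) - q * q)%fps; [ring|].
    replace (q * q + d)%fps with (r * r)%fps; [easy|].
    unfold d, q, r; rewrite !phiM, <- phiD; f_equal; ring. }
  assert (Hs : (s = r * r + q * q)%fps).
  { unfold s, q, r; rewrite !phiM, <- phiD; f_equal; ring. }
  assert (Hq' : (4 * q^` = - q)%fps).
  { transitivity (q * (4 * q^` + q) * r - q * (q * r))%fps;
      [transitivity (4 * q^` * (q * r))%fps; [rewrite Hqr; ring | ring]|].
    replace (4 * q^` + q)%fps with 0%fps; [rewrite Hqr; ring|].
    unfold q; rewrite phi_deriv4, <- phiD, <- phi0; f_equal.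
    - replace (- sinz)%fps with (0 - sinz)%fps by ring.
      rewrite fps_derivB.
      replace (0^`)%fps with 0%fps
        by (apply functional_extensionality; intro; unfold fps_deriv, fps_zero; ring).
      rewrite <- sinz_deriv; ring.
    - transitivity (- (cosz^` + cosz^`) - sinz)%fps; [rewrite cosz_deriv; ring | ring]. }
  assert (He : expneg = (q * q * (q * q))%fps).
  { symmetry; apply expneg_unique.
    - rewrite !fps_derivM; transitivity (4 * q^` * q * q * q)%fps; [ring|].
      rewrite Hq'; ring.
    - simpl; rewrite q0; ring. }
  assert (E1 : (q * q * d = 1 - expneg)%fps).
  { rewrite Hd, He; transitivity (q * r * (q * r) - q * q * (q * q))%fps; [ring|].
    rewrite Hqr; ring. }
  assert (E2 : (q * q * s = 1 + expneg)%fps).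
  { rewrite Hs, He; transitivity (q * r * (q * r) + q * q * (q * q))%fps; [ring|].
    rewrite Hqr; ring. }
  assert (Hv' : forall a, (sinz * (v * a) = a)%fps)
    by (intro a; rewrite fps_mulA, Hv; ring).
  assert (Hu' : forall a, (cosz * (u * a) = a)%fps)
    by (intro a; rewrite fps_mulA, Hu; ring).
  (* The first and second derivatives of [y] with respect to [x = t/4]. *)
  set (y1 := phi 0 (- (2 * Y^`)));
  set (y2 := phi (- (2 * Y^`) + 2 * fps_X * (- (2 * Y^`))^`) 0).
  assert (Hy1 : (4 * y^` = y1)%fps).
  { unfold y, y1; rewrite phi_deriv4; f_equal.
    replace (0^`)%fps with 0%fps
      by (apply functional_extensionality; intro; unfold fps_deriv, fps_zero; ring).
    ring. }
  assert (Hy2 : (4 * y1^` = y2)%fps).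
  { unfold y1, y2; rewrite phi_deriv4; f_equal.
    replace (0^`)%fps with 0%fps
      by (apply functional_extensionality; intro; unfold fps_deriv, fps_zero; ring).
    ring. }
  (* The Legendre equation in [x], multiplied by [2 sinh (2 x)]. By parity only the odd part is
     nontrivial, and it reduces to [HY]. *)
  assert (E0 : (d * (y + y2) + s * (y1 + y1) = 0)%fps).
  { unfold d, s, y, y1, y2; rewrite <- !phiD, !phiM, <- phiD.
    transitivity (phi 0 0); [|apply phi0].
    replace ((- (2 * Y^`))^`)%fps with (- (2 * Y^`^`))%fps.
    2:{ apply functional_extensionality; intro n.
        unfold fps_opp, fps_deriv at 3; rewrite !fps_mulDl, !fps_mul1l.
        unfold fps_add, fps_deriv; ring. }
    f_equal; [ring|].
    transitivity (4 * (cosz * sinz * (Y + fps_X * ((4 * - (sinz^` * v) + 2 * (sinz * u)) * Y^`)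
        - 4 * (Y^` + fps_X * Y^`^`)) ) )%fps; [|rewrite HY; ring].
    transitivity (4 * (cosz * sinz * (Y + 2 * (fps_X * (sinz * (u * Y^`)))
        - 4 * (fps_X * (v * (sinz^` * Y^`)))
        - 4 * (Y^` + fps_X * Y^`^`))))%fps; [|ring].
    transitivity (4 * (cosz * sinz * (Y - 4 * (Y^` + fps_X * Y^`^`))
        + 2 * (fps_X * sinz * sinz * (cosz * (u * Y^`)))
        - 4 * (fps_X * cosz * (sinz * (v * (sinz^` * Y^`))))))%fps; [|ring].
    rewrite Hu', Hv'.
    transitivity (4 * (cosz * sinz * (Y - 4 * (Y^` + fps_X * Y^`^`))
        + 2 * (fps_X * sinz * sinz * Y^`)
        + 2 * cosz * Y^` * (sinz - (sinz + (fps_X * sinz^` + fps_X * sinz^`)))))%fps;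
      [rewrite sinz_deriv|]; ring. }
  (* Multiplying by [q^2 = exp (- t/2)] turns [d] and [s] into [1 - exp (- t)] and
     [1 + exp (- t)]. *)
  assert (E3 : ((1 - expneg) * (y + y2) = - ((1 + expneg) * (y1 + y1)))%fps).
  { rewrite <- E1, <- E2.
    transitivity (q * q * (d * (y + y2) + s * (y1 + y1)) - q * q * s * (y1 + y1))%fps;
      [ring|]; rewrite E0; ring. }
  exists (Y * v)%fps, (Y * u)%fps, (q * y)%fps; repeat split.
  - intro n; apply fps_mul_pos; [easy | now apply sinz_inv_nonneg|].
    assert (H := fps_coef_eq _ _ O Hv); simpl in H; rewrite sinz0 in H; lra.
  - intro n; apply fps_mul_pos; [easy | now apply cosz_inv_nonneg|].
    assert (H := fps_coef_eq _ _ O Hu); simpl in H; rewrite cosz0 in H; lra.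
  - change (q O * Y O = 1); rewrite q0, Y0; ring.
  - assert (Hg1 : (4 * (q * y)^` = q * (y1 - y))%fps).
    { rewrite fps_derivM; transitivity (4 * q^` * y + q * (4 * y^`))%fps; [ring|].
      rewrite Hq', Hy1; ring. }
    assert (Hg2 : (4 * (4 * (q * y)^`^`) = q * (y - (y1 + y1) + y2))%fps).
    { transitivity (4 * (q * (y1 - y))^`)%fps.
      - rewrite <- Hg1; f_equal.
        apply functional_extensionality; intro n.
        unfold fps_deriv at 3; rewrite !fps_mulDl, !fps_mul1l.
        unfold fps_add, fps_deriv; ring.
      - rewrite fps_derivM, fps_derivB.
        transitivity (4 * q^` * (y1 - y) + q * (4 * y1^` - 4 * y^`))%fps; [ring|].
        rewrite Hq', Hy1, Hy2; ring. }
    apply fps_mul4_inj.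
    transitivity ((expneg - 1) * (4 * (4 * (q * y)^`^`)))%fps; [ring|].
    transitivity (4 * (4 * (q * y)^` + q * y))%fps; [|ring].
    rewrite Hg2, Hg1.
    transitivity (- (q * ((1 - expneg) * (y + y2))) + 2 * q * (1 - expneg) * y1)%fps;
      [ring|]; rewrite E3; ring.
  - rewrite <- E1, <- phiX.
    transitivity (q * (phi (Y * v) (Y * u) * d * q))%fps; [ring|].
    transitivity (q * (phi 0 4 * y))%fps; [|ring]; f_equal.
    unfold d, q, y; rewrite !phiM; f_equal.
    + transitivity (4 * (fps_X * cosz * sinz)
        * (sinz * (v * Y) - cosz * (u * Y)))%fps; [ring|].
      rewrite Hu', Hv'; ring.
    + transitivity (4 * (cosz * cosz * (sinz * (v * Y))
        + fps_X * (sinz * sinz) * (cosz * (u * Y))))%fps; [ring|].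
      rewrite Hu', Hv'.
      transitivity (4 * Y * (cosz * cosz + fps_X * (sinz * sinz)))%fps; [ring|].
      rewrite cosz_sinz_sqr; ring.
Qed.

(** * Uniqueness for the differential equation *)

(** The leading factor vanishes at [t = 0], so the equation is singular there: coefficient [n] reads
    [4 (n+1)^2 d_(n+1)] plus terms in [d_0, ..., d_n], and the constant term determines the
    solution. *)
Lemma ode_unique (g h : fps) :
  (4 * ((expneg - 1) * g^`^`) = 4 * g^` + g)%fps ->
  (4 * ((expneg - 1) * h^`^`) = 4 * h^` + h)%fps ->
  g O = h O -> g = h.
Proof.
  intros Hg Hh H0; set (d := (g - h)%fps).
  assert (Hd : (4 * d^` + d + 4 * (fps_X * d^`^`)
      + 4 * (fps_X * (fps_X * (fps_tl expneg_quot * d^`^`))) = 0)%fps).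
  { transitivity (4 * d^` + d - 4 * ((expneg - 1) * d^`^`))%fps.
    - replace (expneg - 1)%fps with (- (fps_X * expneg_quot))%fps
        by (rewrite expneg_quotE; ring).
      (* Split [exp (- t) - 1] into [- t] and a multiple of [t^2]; the latter involves only known
         coefficients. *)
      rewrite (fps_decomp expneg_quot) at 2.
      replace (fps_scal (expneg_quot O) 1) with 1%fps; [ring|].
      apply functional_extensionality; intro.
      unfold fps_scal, expneg_quot; simpl; field.
    - unfold d; rewrite !fps_derivB.
      transitivity ((4 * g^` + g) - (4 * h^` + h) - 4 * ((expneg - 1) * g^`^`)
        + 4 * ((expneg - 1) * h^`^`))%fps; [ring|].
      rewrite Hg, Hh; ring. }
  assert (d0 : forall n, d n = 0).
  { induction n as [n IH] using lt_wf_ind; destruct n as [|n].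
    - unfold d, fps_sub; lra.
    - assert (H := fps_coef_eq _ _ n Hd).
      rewrite !fps_mulDl, !fps_mul1l in H; unfold fps_add in H.
      rewrite fps_X_derivE in H; change (d^`%fps n) with (INR (S n) * d (S n)) in H.
      rewrite (IH n) in H by lia.
      replace ((fps_X * (fps_X * (fps_tl expneg_quot * d^`^`)))%fps n) with 0 in H.
      2:{ destruct n as [|[|n]]; rewrite ?fps_mulX0, ?fps_mulXS, ?fps_mulX0; try easy.
          rewrite (fps_mul_ext n _ (fps_tl expneg_quot) _ 0%fps).
          - rewrite fps_mulC, fps_mul0l; easy.
          - easy.
          - intros k Hk; unfold fps_deriv, fps_zero; rewrite IH by lia; ring. }
      change (fps_zero n) with 0 in H.
      assert (Hn := pos_INR n); rewrite S_INR in H.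
      apply Rmult_eq_reg_l with (4 * (INR n + 1) * (INR n + 1)); nra. }
  apply functional_extensionality; intro n; assert (H := d0 n).
  unfold d, fps_sub in H; lra.
Qed.

(** * Estimates of order [N^(-m)] *)

Definition bigO (m : nat) (f : nat -> R) : Prop :=
  exists C, eventually (fun N => Rabs (f N) * INR N ^ m <= C).

Lemma bigO_ext (m : nat) (f g : nat -> R) :
  eventually (fun N => f N = g N) -> bigO m f -> bigO m g.
Proof.
  intros He [C HC]; exists C.
  generalize (filter_and _ _ He HC); apply filter_imp; now intros N [<- H].
Qed.

Lemma bigO_add (m : nat) (f g : nat -> R) :
  bigO m f -> bigO m g -> bigO m (fun N => f N + g N).
Proof.
  intros [C HC] [C' HC']; exists (C + C').
  generalize (filter_and _ _ HC HC'); apply filter_imp; intros N [H H'].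
  assert (Ht := Rabs_triang (f N) (g N)).
  assert (Hp := pow_le (INR N) m (pos_INR N)); nra.
Qed.

Lemma bigO_scal (m : nat) (r : R) (f : nat -> R) :
  bigO m f -> bigO m (fun N => r * f N).
Proof.
  intros [C HC]; exists (Rabs r * C).
  revert HC; apply filter_imp; intros N H.
  rewrite Rabs_mult; assert (Hr := Rabs_pos r); nra.
Qed.

Lemma eventually_pos : eventually (fun N => 1 <= INR N).
Proof. exists 1%nat; intros N HN; now apply (le_INR 1). Qed.

Lemma bigO_S (m : nat) (f : nat -> R) : bigO (S m) f -> bigO m f.
Proof.
  intros [C HC]; exists C.
  generalize (filter_and _ _ HC eventually_pos); apply filter_imp; intros N [H HN].
  assert (Hp := pow_le (INR N) m (pos_INR N)).
  assert (Hf := Rabs_pos (f N)); rewrite <- tech_pow_Rmult in H.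
  assert (Rabs (f N) * INR N ^ m * 1 <= Rabs (f N) * INR N ^ m * INR N); [|nra].
  apply Rmult_le_compat_l; [now apply Rmult_le_pos | easy].
Qed.

Lemma bigO_mulN (m : nat) (f : nat -> R) :
  bigO (S m) f -> bigO m (fun N => INR N * f N).
Proof.
  intros [C HC]; exists C; revert HC; apply filter_imp; intros N H.
  rewrite Rabs_mult, (Rabs_pos_eq (INR N)) by apply pos_INR.
  rewrite <- tech_pow_Rmult in H; lra.
Qed.

Lemma bigO_shift (m : nat) (f : nat -> R) : bigO m f -> bigO m (fun N => f (S N)).
Proof.
  intros [C [M HC]]; exists C, M; intros N HN.
  apply Rle_trans with (2 := HC (S N) ltac:(lia)).
  apply Rmult_le_compat_l; [apply Rabs_pos|].
  apply pow_incr; split; [apply pos_INR | apply le_INR; lia].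
Qed.

Lemma bigO_divN (m : nat) (f : nat -> R) :
  bigO m f -> bigO (S m) (fun N => f N / INR (S N)).
Proof.
  intros [C HC]; exists C; revert HC; apply filter_imp; intros N H.
  apply Rle_trans with (2 := H).
  assert (HN := pos_INR N); assert (HS := S_INR N).
  unfold Rdiv; rewrite Rabs_mult, (Rabs_pos_eq (/ _))
    by (apply Rlt_le, Rinv_0_lt_compat; lra).
  rewrite <- tech_pow_Rmult, HS.
  replace (Rabs (f N) * / (INR N + 1) * (INR N * INR N ^ m))
    with (Rabs (f N) * INR N ^ m * (INR N / (INR N + 1))) by (field; lra).
  assert (INR N / (INR N + 1) <= 1) by (apply Rle_div_l; lra).
  assert (0 <= Rabs (f N) * INR N ^ m)
    by (apply Rmult_le_pos; [apply Rabs_pos | apply pow_le, pos_INR]).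
  nra.
Qed.

Lemma bigO_monomial (m : nat) (r : R) : bigO m (fun N => r / INR N ^ m).
Proof.
  exists (Rabs r); generalize eventually_pos; apply filter_imp; intros N HN.
  assert (0 < INR N ^ m) by (apply pow_lt; lra).
  unfold Rdiv; rewrite Rabs_mult, (Rabs_pos_eq (/ _))
    by (apply Rlt_le, Rinv_0_lt_compat; lra).
  right; field; lra.
Qed.

(** Otherwise [|r| N] would be bounded. Uniqueness of expansion coefficients rests on this. *)
Lemma bigO_monomial_0 (m : nat) (r : R) :
  bigO (S m) (fun N => r / INR N ^ m) -> r = 0.
Proof.
  intros [C HC]; apply Rabs_eq_0, Rle_antisym; [|apply Rabs_pos].
  apply Rnot_lt_le; intro Hr.
  destruct (INR_unbounded (C / Rabs r)) as [M HM].
  assert (HE : eventually (fun N => (M <= N)%nat)) by (exists M; auto).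
  destruct (filter_and _ _ (filter_and _ _ HC eventually_pos) HE) as [N HN].
  destruct (HN N (le_n N)) as [[H H1] HMN].
  assert (Hp : 0 < INR N ^ m) by (apply pow_lt; lra).
  unfold Rdiv in H; rewrite Rabs_mult, (Rabs_pos_eq (/ _)) in H
    by (apply Rlt_le, Rinv_0_lt_compat; lra).
  rewrite <- tech_pow_Rmult in H.
  replace (Rabs r * / INR N ^ m * (INR N * INR N ^ m)) with (Rabs r * INR N) in H
    by (field; lra).
  apply le_INR in HMN.
  assert (C / Rabs r * Rabs r = C) by (field; lra).
  nra.
Qed.

(** * Asymptotic expansions and their Borel transforms *)

(** A truncated formal Laplace transform: [t^k] becomes [k! / N^(k+1)]. *)
Fixpoint psum (h : fps) (m N : nat) : R :=
  match m with
  | O => 0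
  | S k => psum h k N + INR (fact k) * h k / INR N ^ S k
  end.

(* [h] is the Borel transform of the asymptotic expansion of [f]. *)
Definition asym (f : nat -> R) (h : fps) : Prop :=
  forall m, bigO (S m) (fun N => f N - psum h m N).

Lemma asym_ext (f g : nat -> R) (h : fps) :
  eventually (fun N => f N = g N) -> asym f h -> asym g h.
Proof.
  intros He H m; apply bigO_ext with (2 := H m).
  revert He; apply filter_imp; now intros N ->.
Qed.

Lemma psum_ext (h k : fps) (m N : nat) :
  (forall i, (i < m)%nat -> h i = k i) -> psum h m N = psum k m N.
Proof.
  induction m as [|m IH]; intro H; simpl; [easy|].
  rewrite IH, H by (auto with arith); easy.
Qed.

Lemma psumD (h k : fps) (m N : nat) : psum (h + k)%fps m N = psum h m N + psum k m N.
Proof.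
  induction m as [|m IH]; cbn [psum]; [ring|].
  rewrite IH; unfold fps_add, Rdiv; ring.
Qed.

Lemma psumZ (r : R) (h : fps) (m N : nat) : psum (fps_scal r h) m N = r * psum h m N.
Proof.
  induction m as [|m IH]; cbn [psum]; [ring|].
  rewrite IH; unfold fps_scal, Rdiv; ring.
Qed.

Lemma psum_mulN (h : fps) (m N : nat) : (0 < N)%nat ->
  INR N * psum h (S m) N = h O + psum h^`%fps m N.
Proof.
  intro HN; assert (HN' : INR N <> 0) by (apply not_0_INR; lia).
  induction m as [|m IH]; [simpl; field; easy|].
  change (psum h (S (S m)) N)
    with (psum h (S m) N + INR (fact (S m)) * h (S m) / INR N ^ S (S m)).
  rewrite Rmult_plus_distr_l, IH; cbn [psum].
  unfold fps_deriv; rewrite fact_simpl, mult_INR, <- tech_pow_Rmult.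
  field; auto using pow_nonzero.
Qed.

Lemma asymD (f g : nat -> R) (h k : fps) :
  asym f h -> asym g k -> asym (fun N => f N + g N) (h + k)%fps.
Proof.
  intros Hf Hg m; apply bigO_ext with (2 := bigO_add _ _ _ (Hf m) (Hg m)).
  exists O; intros N _; rewrite psumD; ring.
Qed.

Lemma asymZ (r : R) (f : nat -> R) (h : fps) :
  asym f h -> asym (fun N => r * f N) (fps_scal r h).
Proof.
  intros Hf m; apply bigO_ext with (2 := bigO_scal _ r _ (Hf m)).
  exists O; intros N _; rewrite psumZ; ring.
Qed.

Lemma asymB (f g : nat -> R) (h k : fps) :
  asym f h -> asym g k -> asym (fun N => f N - g N) (h - k)%fps.
Proof.
  intros Hf Hg.
  replace (h - k)%fps with (h + fps_scal (-1) k)%fps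
    by (apply functional_extensionality; intro; unfold fps_add, fps_sub, fps_scal; ring).
  generalize (asymD _ _ _ _ Hf (asymZ (-1) _ _ Hg)); apply asym_ext.
  exists O; intros; ring.
Qed.

(** Expansions start at [1/N], so the constant [h O] produced by the multiplication is
    subtracted. *)
Lemma asym_mulN (f : nat -> R) (h : fps) :
  asym f h -> asym (fun N => INR N * f N - h O) h^`%fps.
Proof.
  intros Hf m; apply bigO_ext with (2 := bigO_mulN _ _ (Hf (S m))).
  exists 1%nat; intros N HN.
  rewrite Rmult_minus_distr_l, psum_mulN by lia; ring.
Qed.

(** The first nonzero coefficient of [h - k] would dominate an expansion of zero. *)
Lemma asym_unique (f : nat -> R) (h k : fps) : asym f h -> asym f k -> h = k.
Proof.
  intros Hh Hk; assert (H := asymB _ _ _ _ Hh Hk).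
  assert (H0 : forall n, (h - k)%fps n = 0).
  { induction n as [n IH] using lt_wf_ind.
    apply Rmult_eq_reg_l with (INR (fact n)); [|apply INR_fact_neq_0].
    rewrite Rmult_0_r; apply bigO_monomial_0 with (S n).
    generalize (bigO_scal _ (-1) _ (H (S n))); apply bigO_ext.
    exists O; intros N _; cbn [psum].
    rewrite (psum_ext (h - k)%fps (fps_scal 0 0%fps)), psumZ.
    - ring.
    - intros i Hi; rewrite IH by easy; unfold fps_scal; ring. }
  apply functional_extensionality; intro n.
  specialize (H0 n); unfold fps_sub in H0; lra.
Qed.

(** Multiplication by [N + 1] acts as [a -> a' + a], up to the constant [a O]; this is the
    converse. *)
Lemma asym_divN (f : nat -> R) (a : fps) :
  asym f (a^` + a)%fps -> asym (fun N => (a O + f N) / INR (S N)) a.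
Proof.
  intros Hf [|m].
  - assert (H : bigO 1 (fun N => (a O + f N) / INR (S N))).
    { apply bigO_divN, bigO_add.
      - generalize (bigO_monomial 0 (a O)); apply bigO_ext.
        exists O; intros; simpl; field.
      - generalize (bigO_S _ _ (Hf O)); apply bigO_ext.
        exists O; intros; simpl; ring. }
    revert H; apply bigO_ext; exists O; intros; simpl psum; ring.
  (* Division gains one order, so order [m] of [f] suffices; the monomial is the last term of
     [psum a (S m)], absent from [psum (a' + a) m]. *)
  - generalize (bigO_divN _ _ (bigO_add _ _ _ (Hf m)
      (bigO_monomial (S m) (- (INR (fact m) * a m))))); apply bigO_ext.
    exists 1%nat; intros N HN.
    assert (Hp := psum_mulN a m N HN); rewrite psumD.
    assert (HS : INR (S N) <> 0) by (apply not_0_INR; lia).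
    replace (psum a (S m) N) with ((INR N + 1) * psum a (S m) N / INR (S N))
      by (rewrite S_INR in *; field; easy).
    rewrite Rmult_plus_distr_r, Hp; cbn [psum]; unfold Rdiv; ring.
Qed.

Lemma asym0 : asym (fun _ => 0) 0%fps.
Proof.
  intro m; exists 0; exists O; intros N _.
  replace (psum 0 m N) with 0.
  - rewrite Rminus_0_r, Rabs_R0; lra.
  - induction m as [|m IH]; cbn [psum]; [easy|].
    rewrite <- IH; unfold fps_zero, Rdiv; ring.
Qed.

Lemma expneg_deriv : (expneg^` = - expneg)%fps.
Proof.
  apply functional_extensionality; intro n.
  unfold fps_deriv, fps_opp, expneg.
  rewrite fact_simpl, mult_INR, <- tech_pow_Rmult.
  assert (Hn := not_0_INR (S n) ltac:(lia)).
  assert (Hf := INR_fact_neq_0 n); field; auto.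
Qed.

Fixpoint fps_Xn (k : nat) : fps :=
  match k with O => 1%fps | S j => (fps_X * fps_Xn j)%fps end.

Lemma fps_XnE (k n : nat) : fps_Xn k n = if Nat.eqb n k then 1 else 0.
Proof.
  revert n; induction k as [|k IH]; intros [|n]; try reflexivity; cbn [fps_Xn].
  - now rewrite fps_mulX0.
  - now rewrite fps_mulXS, IH.
Qed.

Lemma fps_Xn_deriv (k : nat) :
  (fps_Xn (S k))^`%fps = fps_scal (INR (S k)) (fps_Xn k).
Proof.
  apply functional_extensionality; intro n.
  unfold fps_deriv, fps_scal; rewrite !fps_XnE; simpl Nat.eqb.
  destruct (Nat.eqb_spec n k) as [->|]; ring.
Qed.

(** Induction by division by [N + 1]: for [a = t^(k+1) exp (- t)],
    [a' + a = (k+1) t^k exp (- t)]. *)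
Lemma asym_inv_pow (k : nat) :
  asym (fun N => INR (fact k) / INR (S N) ^ S k) (fps_Xn k * expneg)%fps.
Proof.
  induction k as [|k IH].
  - cbn [fps_Xn]; rewrite fps_mul1l.
    assert (H : asym (fun _ => 0) (expneg^` + expneg)%fps).
    { rewrite expneg_deriv; replace (- expneg + expneg)%fps with 0%fps by ring.
      apply asym0. }
    generalize (asym_divN _ _ H); apply asym_ext; exists O; intros N _.
    unfold expneg; rewrite pow_1, pow_O; change (INR (fact 0)) with 1; field.
    apply not_0_INR; lia.
  - set (a := (fps_Xn (S k) * expneg)%fps).
    assert (H : asym (fun N => INR (S k) * (INR (fact k) / INR (S N) ^ S k))
                  (a^` + a)%fps).
    { replace (a^` + a)%fps with (fps_scal (INR (S k)) (fps_Xn k * expneg)%fps).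
      - now apply asymZ.
      - unfold a; rewrite fps_derivM, expneg_deriv, fps_Xn_deriv, fps_mulZl; ring. }
    generalize (asym_divN _ _ H); apply asym_ext; exists O; intros N _.
    replace (a O) with 0 by (unfold a; simpl; unfold fps_X; ring).
    rewrite fact_simpl, mult_INR, <- (tech_pow_Rmult _ (S k)).
    assert (HS : INR (S N) <> 0) by (apply not_0_INR; lia).
    field; auto using pow_nonzero.
Qed.

Fixpoint fps_trunc (h : fps) (m : nat) : fps :=
  match m with
  | O => 0%fps
  | S k => (fps_trunc h k + fps_scal (h k) (fps_Xn k))%fps
  end.

Lemma fps_truncE (h : fps) (m k : nat) :
  fps_trunc h m k = if Nat.ltb k m then h k else 0.
Proof.
  induction m as [|m IH]; [now destruct k|].
  cbn [fps_trunc]; unfold fps_add, fps_scal; rewrite IH, fps_XnE.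
  destruct (Nat.ltb_spec k m), (Nat.eqb_spec k m), (Nat.ltb_spec k (S m)); subst;
    lia || ring.
Qed.

(** Up to an admissible error [f (S N)] is a finite combination of powers of [1/(N+1)], expanded by
    [asym_inv_pow]; truncating [h] at [m] leaves the first [m] coefficients of the product
    unchanged. *)
Lemma asym_shift (f : nat -> R) (h : fps) :
  asym f h -> asym (fun N => f (S N)) (h * expneg)%fps.
Proof.
  intros Hf m.
  assert (Ht : forall m, asym (fun N => psum h m (S N)) (fps_trunc h m * expneg)%fps).
  { clear m; induction m as [|m IH]; cbn [fps_trunc].
    - rewrite fps_mul0l; apply asym0.
    - rewrite fps_mulDl, fps_mulZl.
      generalize (asymD _ _ _ _ IH (asymZ (h m) _ _ (asym_inv_pow m))).
      apply asym_ext; exists O; intros N _; cbn [psum]; unfold Rdiv; ring. }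
  generalize (bigO_add _ _ _ (bigO_shift _ _ (Hf m)) (Ht m m)); apply bigO_ext.
  exists O; intros N _.
  rewrite (psum_ext (h * expneg)%fps (fps_trunc h m * expneg)%fps); [ring|].
  intros i Hi; apply fps_mul_ext; [|easy].
  intros j Hj; rewrite fps_truncE; destruct (Nat.ltb_spec j m); [easy | lia].
Qed.

(** * Expansion of the logarithm *)

Fixpoint ln_poly (m : nat) (x : R) : R :=
  match m with
  | O => 0
  | S k => ln_poly k x + (-1) ^ k / INR (S k) * x ^ S k
  end.

Lemma ln_poly_derive (m : nat) (x : R) : -1 < x ->
  is_derive (fun x => ln (1 + x) - ln_poly m x) x ((- x) ^ m / (1 + x)).
Proof.
  intro Hx; induction m as [|m IH].
  - simpl; auto_derive; [lra | field; lra].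
  - assert (Hp : is_derive (fun x => (-1) ^ m / INR (S m) * x ^ S m) x ((-1) ^ m * x ^ m)).
    { auto_derive; [easy|]; simpl pred.
      assert (Hm := not_0_INR (S m) ltac:(lia)); field; easy. }
    assert (H := is_derive_minus _ _ _ _ _ IH Hp).
    replace ((- x) ^ S m / (1 + x)) with ((- x) ^ m / (1 + x) - (-1) ^ m * x ^ m).
    + revert H; apply is_derive_ext; intro t.
      unfold minus, plus, opp; simpl; ring.
    + rewrite <- Rpow_mult_distr, <- tech_pow_Rmult.
      replace (-1 * x) with (- x) by ring; field; lra.
Qed.

(** Mean value theorem: the remainder vanishes at 0, and its derivative [(- c)^m / (1 + c)] is at
    most [x^m] in absolute value. *)
Lemma ln_poly_bound (m : nat) (x : R) : 0 < x ->
  Rabs (ln (1 + x) - ln_poly m x) <= x ^ S m.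
Proof.
  intro Hx.
  destruct (MVT_cor2 (fun x => ln (1 + x) - ln_poly m x)
    (fun x => (- x) ^ m / (1 + x)) 0 x Hx) as (c & Hc & Hc0).
  { intros c Hc; apply is_derive_Reals, ln_poly_derive; lra. }
  assert (H0 : ln (1 + 0) - ln_poly m 0 = 0).
  { rewrite Rplus_0_r, ln_1; enough (ln_poly m 0 = 0) by lra.
    clear; induction m as [|m IH]; simpl; [easy | rewrite IH; ring]. }
  rewrite H0, !Rminus_0_r in Hc; rewrite Hc.
  unfold Rdiv; rewrite !Rabs_mult, <- RPow_abs, Rabs_Ropp, !Rabs_pos_eq
    by (try apply Rlt_le, Rinv_0_lt_compat; lra).
  assert (Hcm : 0 <= c ^ m) by (apply pow_le; lra).
  assert (Hcx : c ^ m <= x ^ m) by (apply pow_incr; lra).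
  assert (Hi : 0 < / (1 + c)) by (apply Rinv_0_lt_compat; lra).
  assert (Hi1 : / (1 + c) <= 1) by (rewrite <- Rinv_1; apply Rinv_le_contravar; lra).
  rewrite <- tech_pow_Rmult, Rmult_comm; apply Rmult_le_compat_l; [lra|].
  nra.
Qed.

Lemma psum_ln (m N : nat) : (0 < N)%nat -> psum expneg_quot m N = ln_poly m (/ INR N).
Proof.
  intro HN; assert (HN' : INR N <> 0) by (apply not_0_INR; lia).
  induction m as [|m IH]; cbn [psum ln_poly]; [easy|].
  rewrite IH; unfold expneg_quot; rewrite fact_simpl, mult_INR, pow_inv.
  assert (Hn := not_0_INR (S m) ltac:(lia)).
  assert (Hf := INR_fact_neq_0 m); field; auto using pow_nonzero.
Qed.

Lemma asym_ln : asym (fun N => ln (INR (S N)) - ln (INR N)) expneg_quot.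
Proof.
  intro m; exists 1, 1%nat; intros N HN.
  assert (HN' : 0 < INR N) by (apply lt_0_INR; lia).
  rewrite <- ln_div by (try apply lt_0_INR; lia || easy).
  rewrite psum_ln by lia.
  replace (INR (S N) / INR N) with (1 + / INR N) by (rewrite S_INR; field; lra).
  assert (Hi : 0 < / INR N) by (apply Rinv_0_lt_compat; easy).
  assert (Hp : 0 < INR N ^ S m) by (apply pow_lt; easy).
  assert (H := ln_poly_bound m _ Hi); rewrite pow_inv in H.
  apply Rmult_le_compat_r with (r := INR N ^ S m) in H; [|lra].
  rewrite Rinv_l in H; lra.
Qed.

(** * The differential equation for the Landau constants *)

Lemma landau_pred (N : nat) : (0 < N)%nat ->
  landau N = landau (pred N) + dfact_ratio N ^ 2.
Proof.
  destruct N as [|N]; [lia|]; intros _.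
  unfold landau; rewrite sum_Sn; reflexivity.
Qed.

Lemma psum_landau_expansion (alpha : nat -> R) (m n : nat) :
  psum (fun k => alpha (S k) / INR (fact k)) m (n + 1)
  = sum_n_m (fun k => alpha k / INR (n + 1) ^ k) 1 m.
Proof.
  induction m as [|m IH].
  - rewrite sum_n_m_zero by lia; reflexivity.
  - rewrite sum_n_Sm by lia; cbn [psum]; rewrite IH.
    change (@plus R_AbelianMonoid) with Rplus; f_equal.
    assert (Hf := INR_fact_neq_0 m).
    assert (HN := not_0_INR (n + 1) ltac:(lia)).
    field; auto using pow_nonzero.
Qed.

Lemma asym_landau (alpha : nat -> R) : landau_expansion alpha ->
  asym (fun N => PI * landau (pred N) - (ln (16 * INR N) + euler_gamma))
       (fun k => alpha (S k) / INR (fact k)).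
Proof.
  intros H m; destruct (H m) as (C & M & HC); exists C, (S M); intros [|n] HN; [lia|].
  specialize (HC n ltac:(lia)); rewrite <- psum_landau_expansion in HC.
  replace (S m) with (m + 1)%nat by lia; replace (S n) with (n + 1)%nat by lia.
  replace (pred (n + 1)) with n by lia.
  assert (Hp : 0 < INR (n + 1) ^ (m + 1)) by (apply pow_lt, lt_0_INR; lia).
  apply Rle_div_r; [easy|].
  eapply Rle_trans; [|exact HC]; right; f_equal; ring.
Qed.

(* The recurrence [(N+1)^2 D(N+1) = (N+1/2)^2 D(N)] of [D(N) = PI * dfact_ratio N ^ 2]
   becomes a differential equation for the Borel transform of its expansion. *)
Lemma landau_ode (a : fps) :
  asym (fun N => PI * landau (pred N) - (ln (16 * INR N) + euler_gamma)) a ->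
  let g := (a * (expneg - 1) + expneg_quot)%fps in
  (4 * ((expneg - 1) * g^`^`) = 4 * g^` + g)%fps.
Proof.
  intros Ha g.
  set (D := fun N => PI * dfact_ratio N ^ 2).
  (* If [E(N)] is the function expanded in [Ha], then [D(N) = E(N+1) - E(N) + ln (N+1) - ln N]. *)
  assert (HD : asym D g).
  { replace g with ((a * expneg - a) + expneg_quot)%fps by (unfold g; ring).
    generalize (asymD _ _ _ _ (asymB _ _ _ _ (asym_shift _ _ Ha) Ha) asym_ln).
    apply asym_ext; exists 1%nat; intros N HN; unfold D.
    simpl (pred (S N)); rewrite (landau_pred N) by lia.
    rewrite !ln_mult by (lra || apply lt_0_INR; lia); ring. }
  (* Since [(N+1/2)^2 - N^2 = N + 1/4], the functions expanded in [H3] and [H4] are both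
     [(N + 1/4) D(N) - g O]. *)
  assert (H1 := asym_mulN _ _ HD).
  assert (H2 := asym_mulN _ _ H1).
  assert (H3 := asymB _ _ _ _ (asym_shift _ _ H2) H2).
  assert (H4 := asymD _ _ _ _ H1 (asymZ (/ 4) _ _ HD)).
  assert (E : (g^`^` * expneg - g^`^` = g^` + fps_scal (/ 4) g)%fps).
  { apply asym_unique with (1 := H3); revert H4; apply asym_ext.
    exists O; intros N _.
    assert (HS : D (S N) = D N * ((2 * INR N + 1) / (2 * INR N + 2)) ^ 2)
      by (unfold D; simpl; ring).
    rewrite HS, S_INR; assert (HN := pos_INR N); field; lra. }
  transitivity (4 * (g^`^` * expneg - g^`^`))%fps; [ring|]; rewrite E.
  apply functional_extensionality; intro n.
  rewrite !fps_mulDl, !fps_mul1l; unfold fps_add, fps_scal; field.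
Qed.

(** * Signs of the coefficients *)

(** The signs follow the pattern [+ + - -]: two steps of [phi] flip the sign, while the exponent
    grows by the odd number [2 n + 1]. *)
Lemma phi_sign (n : nat) : forall A B : fps,
  (forall k, 0 < A k) -> (forall k, 0 < B k) ->
  0 < (-1) ^ (n * (n - 1) / 2) * phi A B n.
Proof.
  induction n as [n IH] using lt_wf_ind; intros A B HA HB.
  destruct n as [|[|n]].
  - simpl; specialize (HA O); lra.
  - simpl; specialize (HB O); lra.
  - assert (H := IH n ltac:(lia) (fps_tl A) (fps_tl B)
      (fun k => HA (S k)) (fun k => HB (S k))).
    rewrite !phi_tl.
    replace (phi (- fps_tl A)%fps (- fps_tl B)%fps n) with (- phi (fps_tl A) (fps_tl B) n).
    2:{ replace (- fps_tl A)%fps with (fps_scal (-1) (fps_tl A))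
          by (apply functional_extensionality; intro; unfold fps_scal, fps_opp; ring).
        replace (- fps_tl B)%fps with (fps_scal (-1) (fps_tl B))
          by (apply functional_extensionality; intro; unfold fps_scal, fps_opp; ring).
        rewrite phiZ; unfold fps_scal; ring. }
    replace (S (S n) * (S (S n) - 1) / 2)%nat with (n * (n - 1) / 2 + S (2 * n))%nat.
    + rewrite pow_add, pow_1_odd; lra.
    + rewrite <- Nat.div_add by lia; f_equal; destruct n; [easy|]; simpl Nat.sub; nia.
Qed.

Theorem theorem1 (alpha : nat -> R) (Halpha : landau_expansion alpha) (l : nat) :
  (-1) ^ (l * (l + 1) / 2) * alpha (l + 1)%nat < 0.
Proof.
  set (a := fun k => alpha (S k) / INR (fact k) : R).
  assert (Hode := landau_ode a (asym_landau alpha Halpha)); cbv zeta in Hode.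
  set (g := (a * (expneg - 1) + expneg_quot)%fps) in Hode.
  destruct formal_solution as (A & B & h & HA & HB & h0 & Hh & HP).
  assert (Hgh : g = h).
  { apply ode_unique; [exact Hode | exact Hh | rewrite h0].
    unfold g, fps_add, fps_sub, expneg, expneg_quot; simpl; field. }
  (* Both sides times [1 - exp (- t)] equal [t g]; that factor is [fps_X * expneg_quot], cancelled
     in two stages. *)
  assert (HaP : (1 - fps_X * a = phi A B)%fps).
  { apply fps_mul_cancel with expneg_quot; [unfold expneg_quot; simpl; field|].
    apply fps_mulX_cancel.
    transitivity (phi A B * (fps_X * expneg_quot))%fps; [|ring].
    rewrite expneg_quotE, HP, <- Hgh; unfold g.
    transitivity (fps_X * expneg_quot - fps_X * a * (fps_X * expneg_quot))%fps; [ring|].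
    rewrite expneg_quotE at 2; ring. }
  (* Coefficient [S l] of [1 - t a] is [- a l], whence the negative sign and the exponent
     [(l + 1) l / 2]. *)
  assert (H := phi_sign (S l) A B HA HB); rewrite <- HaP in H.
  unfold fps_sub in H; rewrite fps_mulXS in H; change (fps_one (S l)) with 0 in H.
  replace (S l * (S l - 1) / 2)%nat with (l * (l + 1) / 2)%nat in H
    by (f_equal; simpl Nat.sub; lia).
  unfold a in H; replace (l + 1)%nat with (S l) by lia.
  replace (l + 1)%nat with (S l) in H by lia.
  assert (Hf := INR_fact_lt_0 l).
  replace (alpha (S l)) with (alpha (S l) / INR (fact l) * INR (fact l)) by (field; lra).
  set (x := alpha (S l) / INR (fact l)) in *; nra.
Qed.
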